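(* Let $H\in\mathbb{R}^{d\times d}$ be symmetric with eigenvalues $\lambda_1,\dots,\lambda_d$ and corresponding orthonormal eigenvectors $v^{(1)},\dots,v^{(d)}$. Then $$\Vert H\Vert_{\infty,1}\le\sum_{i=1}^d\vert\lambda_i\vert\,\Vert v^{(i)}\Vert_1^2 .$$
   Context: For $H\in\mathbb{R}^{d\times d}$, $\Vert H\Vert_{\infty,1}:=\max_{\Vert x\Vert_\infty\le 1}\Vert Hx\Vert_1$. Eigenvalues are counted with multiplicity. *)

(* Defs.v *)
From mathcomp Require Import all_boot all_order all_algebra.
From mathcomp Require Import all_classical all_reals all_analysis.
Set Implicit Arguments.
Unset Strict Implicit.
Unset Printing Implicit Defensive.
Import Order.TTheory GRing.Theory Num.Theory.
Import numFieldNormedType.Exports.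
Local Open Scope classical_set_scope.
Local Open Scope ring_scope.

Definition l1norm (R : realType) (n : nat) (x : 'cV[R]_n) : R :=
  \sum_(i < n) `|x i 0|.

(* The norm [`|x|] that MathComp-Analysis puts on matrices is the largest
   absolute value of an entry, so on column vectors it is the sup norm.
   The supremum is a maximum: see [norm_inf1_max]. *)
Definition norm_inf1 (R : realType) (m n : nat) (H : 'M[R]_(m, n)) : R :=
  sup [set l1norm (H *m x) | x in [set x : 'cV[R]_n | `|x| <= 1]].

Lemma norm_inf1_max (R : realType) (m n : nat) (H : 'M[R]_(m, n)) :
  exists2 x : 'cV[R]_n, `|x| <= 1 &
    norm_inf1 H = l1norm (H *m x) /\
    forall y : 'cV[R]_n, `|y| <= 1 -> l1norm (H *m y) <= l1norm (H *m x).
Proof.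
have trN (y : 'rV[R]_n) : `|y^T| = `|y|.
  apply/eqP; rewrite eq_le; apply/andP; split; rewrite [leLHS]mx_normrE.
  - apply/bigmax_leP; split=> // -[i j] _ /=; rewrite mxE [leRHS]mx_normrE.
    exact: (le_bigmax _ (fun k : 'I_1 * 'I_n => `|y k.1 k.2|) (j, i)).
  - apply/bigmax_leP; split=> // -[i j] _ /=; rewrite [leRHS]mx_normrE.
    have := le_bigmax 0 (fun k : 'I_n * 'I_1 => `|y^T k.1 k.2|) (j, i).
    by rewrite /= mxE.
pose f (y : 'rV[R]_n) : R := l1norm (H *m y^T).
have cf : continuous f.
  apply: continuous_big; first exact: add_continuous.
  move=> i _ y.
  apply: (@continuous_comp _ _ _ (fun y : 'rV[R]_n => (H *m y^T) i 0)
    (fun t : R => `|t|)); last exact: norm_continuous.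
  have -> : (fun y : 'rV[R]_n => (H *m y^T) i 0)
      = (fun y => \sum_(j < n) H i j * y 0 j).
    by apply/funext => z; rewrite mxE; apply: eq_bigr => j _; rewrite mxE.
  apply: continuous_big; first exact: add_continuous.
  move=> j _ z.
  apply: (@continuousM R 'rV[R]_n (fun=> H i j) (fun y => y 0 j)).
    exact: cst_continuous.
  exact: coord_continuous.
pose A := [set y : 'rV[R]_n | `|y| <= 1].
have cA : compact A.
  apply: bounded_closed_compact.
    by exists 1; split=> // M M1 y /= /le_trans; apply; exact: ltW.
  apply: (@preimage_closed _ _ (fun y : 'rV[R]_n => `|y|) [set t : R | t <= 1]).
    by move=> y _; exact: norm_continuous.
  exact: closed_le.
have A0 : A !=set0 by exists 0; rewrite /A /= normr0.
have [c cA1 cmax] := compact_EVT_max A0 cA (continuous_subspaceT cf).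
have le y : `|y| <= 1 -> l1norm (H *m y) <= f c.
  by move=> y1; rewrite -[y]trmxK; apply: cmax;
    rewrite inE /A /= -trN trmxK.
move: cA1; rewrite inE /A /= => cA1.
exists c^T; first by rewrite trN.
split=> //; apply/eqP; rewrite eq_le; apply/andP; split.
  apply: ge_sup; first by exists (f c), c^T => //=; rewrite trN.
  by move=> _ [y /= y1 <-]; exact: le.
apply: ub_le_sup; first by exists (f c) => _ [y /= y1 <-]; exact: le.
by exists c^T => //=; rewrite trN.
Qed.

(* Main.v *)
(* The [v i] form an orthonormal basis, so
   [H x = \sum_i lambda_i <v_i, x> v_i], and [|<v_i, x>| <= |v_i|_1] whenever
   the sup norm of [x] is at most 1.  The triangle inequality concludes. *)
Require Import Defs.
From mathcomp Require Import all_boot all_order all_algebra.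
From mathcomp Require Import all_classical all_reals all_analysis.
Import Order.TTheory GRing.Theory Num.Theory.
Import numFieldNormedType.Exports.
Local Open Scope ring_scope.

(** Each eigenvector contributes its 1-norm twice: once as the size of the vector [lambda i *: v i]
    in the output ([l1normZ]), once as a bound on the coefficient of [x] along [v i]
    ([ler_dot_l1norm]). [orthonormal_expansion] supplies these coefficients. *)

Lemma l1normZ (R : realType) (n : nat) (a : R) (x : 'cV[R]_n) :
  l1norm (a *: x) = `|a| * l1norm x.
Proof.
by rewrite /l1norm mulr_sumr; apply: eq_bigr => k _; rewrite mxE normrM.
Qed.

Lemma ler_l1norm_sum (R : realType) (n : nat) (I : finType) (F : I -> 'cV[R]_n) :
  l1norm (\sum_i F i) <= \sum_i l1norm (F i).
Proof.
rewrite /l1norm exchange_big /=; apply: ler_sum => k _.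
by rewrite summxE ler_norm_sum.
Qed.

Lemma ler_mx_norm_coord (R : realType) (m n : nat) (x : 'M[R]_(m, n)) i j :
  `|x i j| <= `|x|.
Proof.
rewrite [leRHS]mx_normrE.
exact: (le_bigmax _ (fun k : 'I_m * 'I_n => `|x k.1 k.2|) (i, j)).
Qed.

(** Hölder's inequality for the dual pair of the 1-norm and the sup norm. *)
Lemma ler_dot_l1norm (R : realType) (n : nat) (u x : 'cV[R]_n) :
  `|(u^T *m x) 0 0| <= l1norm u * `|x|.
Proof.
rewrite mxE mulr_suml; apply: le_trans (ler_norm_sum _ _ _) _.
apply: ler_sum => k _; rewrite mxE normrM ler_wpM2l //.
exact: ler_mx_norm_coord.
Qed.

Lemma orthonormal_expansion (R : realType) (d : nat) (v : 'I_d -> 'cV[R]_d)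
    (v_orthonormal : forall i j, (v i)^T *m v j = (i == j)%:R%:M)
    (x : 'cV[R]_d) :
  x = \sum_i ((v i)^T *m x) 0 0 *: v i.
Proof.
pose V := \matrix_(k, i) v i k 0.
have VtV : V^T *m V = 1%:M.
  apply/matrixP => i j; have /matrixP/(_ 0 0) := v_orthonormal i j.
  rewrite !mxE eqxx mulr1n => <-.
  by apply: eq_bigr => k _; rewrite !mxE.
(* [V] is square, so its left inverse [V^T] is also a right inverse, and [x] equals
   [V *m (V^T *m x)]. *)
rewrite -[LHS]mul1mx -(mulmx1C VtV) -mulmxA.
apply/matrixP => k j; rewrite (ord1 j) summxE mxE; apply: eq_bigr => i _.
rewrite !mxE mulrC; congr (_ * _).
by apply: eq_bigr => l _; rewrite !mxE.
Qed.

Theorem proposition5 (R : realType) (d : nat) (H : 'M[R]_d)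
    (lambda : 'I_d -> R) (v : 'I_d -> 'cV[R]_d)
    (H_sym : H^T = H)
    (v_eigen : forall i, H *m v i = lambda i *: v i)
    (v_orthonormal : forall i j, (v i)^T *m v j = (i == j)%:R%:M) :
  norm_inf1 H <= \sum_(i < d) `|lambda i| * l1norm (v i) ^+ 2.
Proof.
(* The supremum is attained, so it suffices to bound [l1norm (H *m x)] at a maximizer [x]. *)
have [x x1 [-> _]] := norm_inf1_max H.
rewrite [in leLHS](orthonormal_expansion _ _ _ v_orthonormal x) mulmx_sumr.
apply: le_trans (ler_l1norm_sum _ _ _ _) _; apply: ler_sum => i _.
have v_ge0 : 0 <= l1norm (v i) by apply: sumr_ge0.
(* Cancelling [lambda i] and one factor [l1norm (v i)] leaves a bound on the coefficient of [x]
   along [v i]. *)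
rewrite -scalemxAr v_eigen !l1normZ mulrCA ler_wpM2l // expr2 ler_wpM2r //.
apply: le_trans (ler_dot_l1norm _ _ _ _) _.
by rewrite -[leRHS]mulr1 ler_wpM2l.
Qed.
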